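(* Let $f_c(\rho)=Q(c\rho)$. There exists $\varepsilon>0$ such that, for every $c$ with $c_\ast<c<c_\ast+\varepsilon$, the map $f_c$ has two positive fixed points $\rho_-(c)<\rho_+(c)$ near $\rho_\ast$ (that is, on two branches with $\rho_\pm(c)\to\rho_\ast$ as $c\downarrow c_\ast$). The smaller branch $\rho_-(c)$ is unstable, while the larger branch $\rho_+(c)$ is locally asymptotically stable. Moreover $\rho=0$ is also a locally asymptotically stable fixed point of $f_c$, so the map $f_c$ is bistable in this parameter range.
   Context: Define $\Phi(\lambda)=\sum_{p\ \mathrm{prime}}\frac{\lambda^p}{p!}$ and $Q(\lambda)=e^{-\lambda}\Phi(\lambda)$ for $\lambda\ge 0$ (so $Q(0)=0$), and $c(\lambda)=\lambda/Q(\lambda)$ for $\lambda>0$. The function $c(\lambda)$ has a unique global minimizer $\lambda_\ast\approx1.408509$ on $(0,\infty)$; set $\rho_\ast=Q(\lambda_\ast)\approx 0.368241$ and $c_\ast=c(\lambda_\ast)\approx3.824963$. For $c>0$, the mean-field map $f_c$ acts on densities $\rho\in[0,1]$ and defines the discrete-time dynamical system $\rho_{t+1}=f_c(\rho_t)$; stability, instability and local asymptotic stability of fixed points are meant in the usual sense for this one-dimensional iteration. Bistable means that there are at least two distinct locally asymptotically stable fixed points. *)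

(* Defs.v *)
(* Stdlib reals with Coquelicot. *)
From Stdlib Require Import Reals Lra Lia ZArith Znumtheory ClassicalEpsilon.
From Coquelicot Require Import Coquelicot.
Open Scope R_scope.

Definition prime_coef (n : nat) : R :=
  if prime_dec (Z.of_nat n) then / INR (fact n) else 0.

Definition Phi (lambda : R) : R := PSeries prime_coef lambda.

Definition Q (lambda : R) : R := exp (- lambda) * Phi lambda.

(* The function c(lambda); only its values on (0, +oo) are used, where Q > 0
   (Q_pos below). *)
Definition cfun (lambda : R) : R := lambda / Q lambda.

Definition is_global_minimizer (l : R) : Prop :=
  0 < l /\ forall x, 0 < x -> cfun l <= cfun x.

Lemma prime_coef_bounds n : 0 <= prime_coef n <= / INR (fact n).
Proof.
assert (H := Rinv_0_lt_compat _ (INR_fact_lt_0 n)).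
unfold prime_coef; destruct (prime_dec _); lra.
Qed.

Lemma prime_coef_lt2 k : (k < 2)%nat -> prime_coef k = 0.
Proof.
intros Hk; unfold prime_coef; destruct (prime_dec _) as [[H _]|_]; [lia|easy].
Qed.

Lemma prime_coef_2 : prime_coef 2 = / 2.
Proof.
unfold prime_coef; destruct (prime_dec _) as [_|H].
- simpl; f_equal; lra.
- now destruct H; apply prime_2.
Qed.

Lemma CV_radius_prime_coef x : Rbar_lt (Rabs x) (CV_radius prime_coef).
Proof.
destruct (CV_radius_bounded prime_coef) as [H _].
assert (Hx := Rabs_pos x).
apply Rbar_lt_le_trans with (Rabs x + 1); [simpl; lra|].
apply H; set (r := Rabs x + 1).
assert (Hr : 0 <= r) by (unfold r; lra).
exists (exp r); intros n.
assert (Hp := pow_le r n Hr); assert (Hb := prime_coef_bounds n).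
rewrite Rabs_pos_eq by (apply Rmult_le_pos; lra).
apply Rle_trans with (r ^ n / INR (fact n)).
- unfold Rdiv; rewrite Rmult_comm; apply Rmult_le_compat_l; lra.
- apply Rle_trans with (2 := exp_ge_taylor r n Hr).
  destruct n as [|n]; [simpl; lra|].
  rewrite tech5.
  assert (0 <= sum_f_R0 (fun k => r ^ k / INR (fact k)) n); [|lra].
  apply cond_pos_sum; intros k.
  apply Rdiv_le_0_compat; [now apply pow_le|apply INR_fact_lt_0].
Qed.

Lemma Phi_bound_aux x : 0 < x ->
  / 2 <= PSeries (PS_decr_n prime_coef 2) x <= exp x.
Proof.
intros Hx.
assert (Hb : forall n, 0 <= PS_decr_n prime_coef 2 n * x ^ n
                       <= / INR (fact n) * x ^ n).
{ intros n; assert (Hp := pow_le x n (Rlt_le _ _ Hx)).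
  unfold PS_decr_n; assert (Hc := prime_coef_bounds (2 + n)).
  assert (Hf : / INR (fact (2 + n)) <= / INR (fact n)).
  { apply Rinv_le_contravar; [apply INR_fact_lt_0|].
    apply le_INR, fact_le; lia. }
  split; [apply Rmult_le_pos; lra|apply Rmult_le_compat_r; lra]. }
assert (He := is_exp_Reals x).
assert (Hex : ex_series (fun n => / INR (fact n) * x ^ n)).
{ exists (exp x); revert He; apply is_series_ext; intros n.
  rewrite pow_n_pow; apply Rmult_comm. }
split.
- assert (Hex' : ex_series (fun n => PS_decr_n prime_coef 2 n * x ^ n)).
  { apply (ex_series_le (K := R_AbsRing) (V := R_CompleteNormedModule))
      with (2 := Hex); intros n; specialize (Hb n).
    change (Rabs (PS_decr_n prime_coef 2 n * x ^ n)
            <= / INR (fact n) * x ^ n).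
    rewrite Rabs_pos_eq; lra. }
  unfold PSeries; rewrite Series_incr_1 by exact Hex'.
  change (PS_decr_n prime_coef 2 0) with (prime_coef 2).
  rewrite prime_coef_2.
  assert (H : 0 <= Series (fun k => PS_decr_n prime_coef 2 (S k) * x ^ S k)).
  { replace 0 with (Series (fun _ => 0 * 0)).
    - apply Series_le.
      + intros n; specialize (Hb (S n)); lra.
      + now apply ex_series_incr_1 in Hex'.
    - rewrite Series_scal_l; ring. }
  simpl (x ^ 0); lra.
- replace (exp x) with (Series (fun n => / INR (fact n) * x ^ n)).
  + now apply Series_le.
  + apply (is_pseries_unique _ _ _ He).
Qed.

Lemma Phi_le_exp x : 0 < x -> Phi x <= exp x.
Proof.
intros Hx; rewrite <- (is_pseries_unique _ _ _ (is_exp_Reals x)).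
apply Series_le.
- intros n; assert (Hp := pow_le x n (Rlt_le _ _ Hx)).
  assert (Hc := prime_coef_bounds n).
  split; [apply Rmult_le_pos; lra|apply Rmult_le_compat_r; lra].
- exists (exp x); generalize (is_exp_Reals x); apply is_series_ext; intros n.
  rewrite pow_n_pow; apply Rmult_comm.
Qed.

Lemma Q_bounds x : 0 < x -> 0 < Q x /\ Q x <= 1 /\ Q x <= x ^ 2.
Proof.
intros Hx; unfold Q.
assert (He := exp_pos (- x)).
assert (Hee : exp (- x) * exp x = 1)
  by (rewrite <- exp_plus, Rplus_opp_l; apply exp_0).
assert (Hd : Phi x = x ^ 2 * PSeries (PS_decr_n prime_coef 2) x)
  by (apply PSeries_decr_n_aux, prime_coef_lt2).
assert (Hb := Phi_bound_aux x Hx); assert (Hx2 : 0 < x ^ 2) by (apply pow_lt; lra).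
split; [|split].
- apply Rmult_lt_0_compat; [easy|]; rewrite Hd.
  apply Rmult_lt_0_compat; lra.
- rewrite <- Hee; apply Rmult_le_compat_l; [lra|now apply Phi_le_exp].
- apply Rle_trans with (exp (- x) * (x ^ 2 * exp x)).
  + apply Rmult_le_compat_l; [lra|]; rewrite Hd.
    apply Rmult_le_compat_l; lra.
  + apply Req_le; rewrite <- (Rmult_1_r (x ^ 2)) at 2; rewrite <- Hee; ring.
Qed.

Lemma Q_pos x : 0 < x -> 0 < Q x.
Proof. intros Hx; apply (Q_bounds x Hx). Qed.

Lemma Q_continuity : continuity Q.
Proof.
intros x; apply continuity_pt_mult.
- apply (continuity_pt_comp Ropp exp).
  + apply continuity_pt_opp, derivable_continuous_pt, derivable_pt_id.
  + apply derivable_continuous_pt, derivable_pt_exp.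
- apply PSeries_continuity, CV_radius_prime_coef.
Qed.

Lemma global_minimizer_exists : exists l, is_global_minimizer l.
Proof.
assert (Hlow : forall x, 0 < x -> x <= cfun x /\ / x <= cfun x).
{ intros x Hx; destruct (Q_bounds x Hx) as [H0 [H1 H2]]; unfold cfun; split.
  - apply Rle_div_r; [easy|].
    apply Rle_trans with (x * 1); [apply Rmult_le_compat_l|]; lra.
  - apply Rle_div_r; [easy|].
    apply Rle_trans with (/ x * x ^ 2).
    + apply Rmult_le_compat_l; [now apply Rlt_le, Rinv_0_lt_compat|easy].
    + apply Req_le; field; lra. }
set (m := cfun 1).
assert (Hm : 1 <= m) by (apply (Hlow 1); lra).
assert (Him : 0 < / m <= 1).
{ split; [apply Rinv_0_lt_compat; lra|].
  rewrite <- Rinv_1; apply Rinv_le_contravar; lra. }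
destruct (continuity_ab_min cfun (/ m) m) as [l [Hl Hlm]].
- lra.
- intros x Hx; apply continuity_pt_div.
  + apply derivable_continuous_pt, derivable_pt_id.
  + apply Q_continuity.
  + apply Rgt_not_eq, Q_pos; lra.
- exists l; split; [lra|]; intros x Hx.
  destruct (Hlow x Hx) as [H1 H2].
  assert (Hl1 : cfun l <= m) by (apply Hl; lra).
  destruct (Rle_dec x m) as [Hxm|Hxm]; [|lra].
  destruct (Rle_dec (/ m) x) as [Hmx|Hmx]; [apply Hl; lra|].
  assert (m <= / x); [|lra].
  rewrite <- (Rinv_inv m); apply Rinv_le_contravar; lra.
Qed.

Definition lambda_star : R :=
  proj1_sig (constructive_indefinite_description _ global_minimizer_exists).

Lemma lambda_star_spec : is_global_minimizer lambda_star.
Proof. exact (proj2_sig (constructive_indefinite_description _ _)). Qed.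

Definition rho_star : R := Q lambda_star.
Definition c_star : R := cfun lambda_star.

Definition mean_field (c rho : R) : R := Q (c * rho).

(* One-dimensional iteration on the state space [0,1]: all notions are relative
   to [0,1], so at the endpoint 0 only perturbations inside [0,1] count. *)
Definition density (x : R) : Prop := 0 <= x <= 1.

Definition orbit (g : R -> R) (x : R) (t : nat) : R := Nat.iter t g x.

Definition is_fixed_point (g : R -> R) (x : R) : Prop := density x /\ g x = x.

Definition stable (g : R -> R) (x : R) : Prop :=
  forall eps, 0 < eps -> exists delta, 0 < delta /\
    forall y, density y -> Rabs (y - x) < delta ->
    forall t, Rabs (orbit g y t - x) < eps.

Definition unstable (g : R -> R) (x : R) : Prop := ~ stable g x.

Definition attractive (g : R -> R) (x : R) : Prop :=
  exists delta, 0 < delta /\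
    forall y, density y -> Rabs (y - x) < delta ->
    is_lim_seq (orbit g y) x.

Definition locally_asymptotically_stable (g : R -> R) (x : R) : Prop :=
  stable g x /\ attractive g x.

Definition bistable (g : R -> R) : Prop :=
  exists x y, x <> y /\
    (is_fixed_point g x /\ locally_asymptotically_stable g x) /\
    (is_fixed_point g y /\ locally_asymptotically_stable g y).

(* The density interval is invariant, so orbits never leave the state space. *)
Lemma mean_field_density c rho :
  0 < c -> density rho -> density (mean_field c rho).
Proof.
intros Hc [H0 H1]; unfold density, mean_field.
destruct (Req_dec rho 0) as [->|Hr].
- rewrite Rmult_0_r; unfold Q, Phi; rewrite PSeries_0, prime_coef_lt2 by lia; lra.
- destruct (Q_bounds (c * rho)); [apply Rmult_lt_0_compat|]; lra.
Qed.

(* Main.v *)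
Require Import Defs.
From Stdlib Require Import Reals Ranalysis5 Lra Lia ZArith Znumtheory.
From Stdlib Require Import ClassicalEpsilon.
From Coquelicot Require Import Coquelicot.
Open Scope R_scope.

(** With [lambda = c * rho], a positive density [rho] is fixed by [mean_field c]
    exactly when [cfun lambda = c], and [mean_field c] moves [rho] up or down
    according to whether [cfun lambda] is below or above [c].  Hence everything
    follows from the shape of [cfun] near its minimizer: if it strictly
    decreases up to [lambda_star] and strictly increases just after it, then
    each [c] slightly above the minimum [c_star] has one preimage on each side.
    These preimages, divided by [c], are the two fixed points, and their
    continuity in [c] is the continuity of the inverse of a monotone function.

    Stability needs no linearization.  The densities between the two fixed
    points move up, away from the lower one, which is therefore unstable.
    Those below the lower one move down, so [0] attracts.  Those just above the
    upper one move down, those just below it move up, and neither can jump over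
    it because [Q] is increasing near [lambda_star]; a monotone orbit converges
    to a fixed point, so the upper one attracts.  The same argument gives
    stability, since orbits only get closer to their limit.

    The shape of [cfun] comes from the identity
      Q^2 cfun' = Q - x Q' = e^(-x) ((1 + x) Phi - x Phi') = e^(-x) x^2 slope,
    where [slope] is again an entire series.  Its derivative is positive on
    (0, 4] ([Derive_slope_pos]): a polynomial of degree 5 dominates the tail.
    So [slope] has at most one zero there.  As [cfun x >= x] while
    [cfun (3/2) < 4], the minimizer lies in (0, 4) ([lambda_star_lt_4]) and is
    that zero, with [slope] negative before it and positive after it.  The same
    identity gives [x Q' = Q > 0] at [lambda_star], whence [Q] increases
    near it. *)

(** * Power series with factorially small coefficients *)

(** A term of the exponential series at [r] is at most [exp r], so the terms
    [a n * r ^ n] stay bounded for every radius [r]. *)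
Lemma CV_radius_le_inv_fact (a : nat -> R) (x : R) :
  (forall n, Rabs (a n) <= / INR (fact n)) -> Rbar_lt (Rabs x) (CV_radius a).
Proof.
intros Ha.
destruct (CV_radius_bounded a) as [H _].
assert (Hx := Rabs_pos x).
apply Rbar_lt_le_trans with (Rabs x + 1); [simpl; lra|].
apply H; set (r := Rabs x + 1).
assert (Hr : 0 <= r) by (unfold r; lra).
exists (exp r); intros n.
assert (Hp := pow_le r n Hr).
rewrite Rabs_mult, (Rabs_pos_eq _ Hp).
apply Rle_trans with (sum_f_R0 (fun k => r ^ k / INR (fact k)) n);
  [|now apply exp_ge_taylor].
assert (Hn : forall k, 0 <= r ^ k / INR (fact k)).
{ intros k; apply Rdiv_le_0_compat; [now apply pow_le|apply INR_fact_lt_0]. }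
apply Rle_trans with (r ^ n / INR (fact n)).
- unfold Rdiv; rewrite Rmult_comm; now apply Rmult_le_compat_l.
- destruct n as [|n]; [simpl; lra|].
  rewrite tech5; assert (H0 := cond_pos_sum _ n Hn); lra.
Qed.

(** Comparison with a geometric series of ratio [q]; it serves to bound the tail
    of a series cut after a few explicit terms. *)
Lemma PSeries_abs_le_geom (b : nat -> R) (C r q x : R) :
  0 <= C -> 0 < r -> 0 <= q < 1 -> 0 <= x <= q * r ->
  (forall j, Rabs (b j) <= C / r ^ j) ->
  Rabs (PSeries b x) <= C / (1 - q).
Proof.
intros HC Hr Hq Hx Hb.
assert (Hg : is_series (fun n => C * q ^ n) (C * / (1 - q))).
{ apply (is_series_scal C (fun n => q ^ n)), is_series_geom.
  rewrite Rabs_pos_eq; lra. }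
assert (Hle : forall n, 0 <= Rabs (b n * x ^ n) <= C * q ^ n).
{ intros n; split; [apply Rabs_pos|].
  assert (Hxn := pow_le x n (proj1 Hx)).
  rewrite Rabs_mult, (Rabs_pos_eq _ Hxn).
  assert (Hrn := pow_lt r n Hr).
  apply Rle_trans with (C / r ^ n * (q * r) ^ n).
  - apply Rmult_le_compat; [apply Rabs_pos|easy|easy|now apply pow_incr].
  - rewrite Rpow_mult_distr; right; field; lra. }
apply Rle_trans with (Series (fun n => Rabs (b n * x ^ n))).
- apply Series_Rabs.
  apply (ex_series_le (K := R_AbsRing) (V := R_CompleteNormedModule))
    with (b := fun n => C * q ^ n).
  + intros n; change (Rabs (Rabs (b n * x ^ n)) <= C * q ^ n).
    rewrite Rabs_Rabsolu; apply Hle.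
  + now exists (C * / (1 - q)).
- unfold Rdiv; rewrite <- (is_series_unique _ _ Hg).
  apply Series_le; [exact Hle|now exists (C * / (1 - q))].
Qed.

(** * The first coefficients of Phi *)

Lemma not_prime_mul (p q : Z) : (1 < p -> 1 < q -> ~ prime (p * q))%Z.
Proof.
intros Hp Hq H; apply prime_alt in H; destruct H as [_ H].
apply (H p); [nia|exists q; ring].
Qed.

Lemma prime_5 : prime 5.
Proof.
apply prime_alt; split; [lia|]; intros n Hn [q Hq].
assert (n = 2 \/ n = 3 \/ n = 4)%Z by lia; lia.
Qed.

Lemma prime_7 : prime 7.
Proof.
apply prime_alt; split; [lia|]; intros n Hn [q Hq].
assert (n = 2 \/ n = 3 \/ n = 4 \/ n = 5 \/ n = 6)%Z by lia; lia.
Qed.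

Lemma prime_coef_prime n : prime (Z.of_nat n) -> prime_coef n = / INR (fact n).
Proof. intros H; unfold prime_coef; now destruct (prime_dec _). Qed.

Lemma prime_coef_not_prime n : ~ prime (Z.of_nat n) -> prime_coef n = 0.
Proof. intros H; unfold prime_coef; now destruct (prime_dec _). Qed.

Lemma prime_coef_le_8 :
  prime_coef 3 = / 6 /\ prime_coef 4 = 0 /\ prime_coef 5 = / 120 /\
  prime_coef 6 = 0 /\ prime_coef 7 = / 5040 /\ prime_coef 8 = 0.
Proof.
repeat split.
- rewrite prime_coef_prime by exact prime_3; f_equal; simpl; lra.
- apply prime_coef_not_prime, (not_prime_mul 2 2); lia.
- rewrite prime_coef_prime by exact prime_5; f_equal; simpl; lra.
- apply prime_coef_not_prime, (not_prime_mul 2 3); lia.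
- rewrite prime_coef_prime by exact prime_7; f_equal.
  rewrite INR_IZR_INZ; f_equal.
- apply prime_coef_not_prime, (not_prime_mul 2 4); lia.
Qed.

(** * The series that governs the sign of the derivative of cfun *)

(** The coefficient of x^(m+2) in (1 + x) Phi - x Phi'. *)
Definition slope_coef (m : nat) : R :=
  prime_coef (S m) - INR (S m) * prime_coef (S (S m)).

Definition slope (x : R) : R := PSeries slope_coef x.

Lemma inv_fact_S n : / INR (fact n) = INR (S n) * / INR (fact (S n)).
Proof.
rewrite fact_simpl, mult_INR; field; split.
- apply INR_fact_neq_0.
- now apply not_0_INR.
Qed.

Lemma inv_fact_decr n : / INR (fact (S n)) <= / INR (fact n).
Proof.
apply Rinv_le_contravar; [apply INR_fact_lt_0|apply le_INR, fact_le; lia].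
Qed.

(** Both terms lie between 0 and 1/(m+1)!, hence so does the absolute value of
    their difference. *)
Lemma slope_coef_bound m : Rabs (slope_coef m) <= / INR (fact (S m)).
Proof.
unfold slope_coef.
assert (H1 := prime_coef_bounds (S m)).
assert (H2 := prime_coef_bounds (S (S m))).
assert (H3 := pos_INR (S m)); assert (H4 := inv_fact_S (S m)).
assert (H5 : 0 <= INR (S m) * prime_coef (S (S m)) <= / INR (fact (S m))).
{ split; [now apply Rmult_le_pos|].
  rewrite H4, (S_INR (S m)); apply Rmult_le_compat; lra. }
apply Rabs_le; lra.
Qed.

Lemma CV_radius_slope x : Rbar_lt (Rabs x) (CV_radius slope_coef).
Proof.
apply CV_radius_le_inv_fact; intros n.
apply Rle_trans with (1 := slope_coef_bound n), inv_fact_decr.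
Qed.

Lemma PS_derive_slope_coef_bound m :
  Rabs (PS_derive slope_coef m) <= / INR (fact (S m)).
Proof.
unfold PS_derive; rewrite Rabs_mult, (Rabs_pos_eq _ (pos_INR _)).
rewrite (inv_fact_S (S m)).
apply Rmult_le_compat; [apply pos_INR|apply Rabs_pos| |apply slope_coef_bound].
apply le_INR; lia.
Qed.

(** Here 5040 is 7!, and every factor beyond it is at least 8. *)
Lemma inv_fact_geom j : / INR (fact (7 + j)) <= / 5040 / 8 ^ j.
Proof.
induction j as [|j IH].
- replace (INR (fact (7 + 0))) with 5040; [simpl; lra|].
  rewrite INR_IZR_INZ; f_equal.
- replace (7 + S j)%nat with (S (7 + j)) by lia.
  rewrite inv_fact_S in IH.
  assert (H8 : 8 <= INR (S (7 + j))).
  { replace 8 with (INR 8) by (simpl; lra); apply le_INR; lia. }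
  assert (Hp := Rinv_0_lt_compat _ (INR_fact_lt_0 (S (7 + j)))).
  assert (Hq := pow_lt 8 j ltac:(lra)).
  replace (/ 5040 / 8 ^ S j) with (/ 5040 / 8 ^ j / 8) by (simpl; field; lra).
  apply Rle_div_r; [lra|]. nra.
Qed.

(** The terms of degree at most 5 are 1/6 + x/3 - x^2/10 + x^3/30 - x^4/168
    + x^5/840.  The remaining ones are bounded by (x^6/7!) (1 + x/8 + ...),
    which is at most 2 x^6/7! on this interval. *)
Lemma Derive_slope_pos x : 0 < x <= 4 -> 0 < PSeries (PS_derive slope_coef) x.
Proof.
intros Hx.
assert (Hr : ex_pseries (PS_derive slope_coef) x).
{ apply CV_radius_inside; rewrite CV_radius_derive; apply CV_radius_slope. }
rewrite (PSeries_decr_n _ 5 _ Hr).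
assert (Ht : Rabs (PSeries (PS_decr_n (PS_derive slope_coef) 6) x)
             <= / 5040 / (1 - / 2)).
{ apply (PSeries_abs_le_geom _ _ 8); try lra.
  intros j; apply Rle_trans with (2 := inv_fact_geom j).
  apply (PS_derive_slope_coef_bound (6 + j)). }
apply Rabs_le_between in Ht.
destruct prime_coef_le_8 as (H3 & H4 & H5 & H6 & H7 & H8).
unfold sum_f_R0, PS_derive at 1 2 3 4 5 6, slope_coef at 1 2 3 4 5 6.
rewrite prime_coef_2, H3, H4, H5, H6, H7, H8.
set (t := PSeries _ x) in *; clearbody t; simpl INR.
assert (Hx6 : x ^ 6 * - (/ 5040 / (1 - / 2)) <= x ^ 6 * t).
{ apply Rmult_le_compat_l; [apply pow_le|]; lra. }
(* The top terms combine to x^5 (3 - x) / 2520, at least - x^4 / 630.  Replacing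
   x^4 by 4 x^3 and then x^3 by its lower bound 8 x^2 - 16 x leaves a concave
   quadratic that is positive at 0 and at 4. *)
assert (Hx5 : x ^ 4 * - 4 <= x ^ 4 * (x * (3 - x))).
{ apply Rmult_le_compat_l; [apply pow_le; lra|nra]. }
assert (Hx4 : x ^ 3 * x <= x ^ 3 * 4)
  by (apply Rmult_le_compat_l; [apply pow_le|]; lra).
assert (Hx1 : 0 <= x * (x - 4) ^ 2)
  by (apply Rmult_le_pos; [lra|apply pow2_ge_0]).
assert (Hx2 : x * x <= x * 4) by (apply Rmult_le_compat_l; lra).
lra.
Qed.

Lemma slope_increasing x y : 0 < x -> x < y -> y <= 4 -> slope x < slope y.
Proof.
intros Hx Hxy Hy.
apply (incr_function_le slope x y (PSeries (PS_derive slope_coef))); simpl; try lra.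
- intros z _ _; apply is_derive_PSeries, CV_radius_slope.
- intros z Hz1 Hz2; apply Derive_slope_pos; lra.
Qed.

(** The terms of degree 0 and 1 of (1 + x) Phi - x Phi' vanish because the
    smallest prime is 2, so that x^2 factors out. *)
Lemma slope_spec x :
  x ^ 2 * slope x = (1 + x) * Phi x - x * PSeries (PS_derive prime_coef) x.
Proof.
assert (Ha : ex_pseries prime_coef x)
  by apply CV_radius_inside, CV_radius_prime_coef.
assert (Hd : ex_pseries (PS_derive prime_coef) x)
  by (apply CV_radius_inside; rewrite CV_radius_derive; apply CV_radius_prime_coef).
transitivity (PSeries (PS_incr_1 (PS_incr_1 slope_coef)) x).
{ rewrite !PSeries_incr_1; unfold slope; ring. }
transitivity (Phi x + x * Phi x - x * PSeries (PS_derive prime_coef) x); [|ring].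
unfold Phi; rewrite <- !PSeries_incr_1, <- PSeries_plus, <- PSeries_minus.
- apply PSeries_ext; intros [|[|n]];
    unfold PS_minus, PS_plus, PS_opp, PS_incr_1, PS_derive, slope_coef;
    change plus with Rplus; change opp with Ropp; change zero with 0.
  + rewrite prime_coef_lt2 by lia; ring.
  + rewrite !prime_coef_lt2 by lia; ring.
  + rewrite (S_INR (S n)); ring.
- apply ex_pseries_plus; [|apply ex_pseries_incr_1]; exact Ha.
- now apply ex_pseries_incr_1.
- exact Ha.
- now apply ex_pseries_incr_1.
Qed.

(** * Monotonicity of cfun and Q around the minimizer *)

Lemma is_derive_Q x :
  is_derive Q x (exp (- x) * (PSeries (PS_derive prime_coef) x - Phi x)).
Proof.
assert (H := is_derive_PSeries prime_coef x (CV_radius_prime_coef x)).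
unfold Q, Phi; auto_derive.
- now exists (PSeries (PS_derive prime_coef) x).
- replace (Derive _ x) with (PSeries (PS_derive prime_coef) x); [ring|].
  symmetry; now apply is_derive_unique.
Qed.

Lemma Q_elasticity x : Q x - x * Derive Q x = exp (- x) * (x ^ 2 * slope x).
Proof.
rewrite (is_derive_unique _ _ _ (is_derive_Q x)), slope_spec; unfold Q; ring.
Qed.

Lemma is_derive_cfun x :
  0 < x -> is_derive cfun x (exp (- x) * (x ^ 2 * slope x) / Q x ^ 2).
Proof.
intros Hx; assert (HQ := Q_pos x Hx).
assert (H := is_derive_div (fun t => t) Q x 1 (Derive Q x) (is_derive_id x)
  (Derive_correct Q x (ex_intro _ _ (is_derive_Q x))) ltac:(lra)).
rewrite <- Q_elasticity.
now replace (Q x - x * Derive Q x) with (1 * Q x - x * Derive Q x) by ring.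
Qed.

(** Since [Q <= 1], [cfun x >= x], so a minimizer beyond 4 would have a value of
    at least 4; but [cfun (3/2)] is about 3.83. *)
Lemma lambda_star_lt_4 : lambda_star < 4.
Proof.
destruct lambda_star_spec as [H0 Hmin].
destruct (Rlt_le_dec lambda_star 4) as [H4|H4]; [exact H4|exfalso].
assert (Hlow : 4 <= cfun lambda_star).
{ unfold cfun; destruct (Q_bounds _ H0) as [HQ [HQ1 _]].
  apply (Rle_div_r 4 lambda_star (Q lambda_star) HQ); lra. }
(* The primes 2, 3 and 5 alone contribute 1.7508 to Phi (3/2). *)
assert (HPhi : 7 / 4 <= Phi (3 / 2)).
{ assert (He : ex_pseries prime_coef (3 / 2))
    by apply CV_radius_inside, CV_radius_prime_coef.
  apply ex_pseries_R, Series_correct, is_series_Reals in He.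
  apply Rle_trans with (2 := sum_incr _ 5 _ He ltac:(
    intros n; apply Rmult_le_pos; [apply prime_coef_bounds|apply pow_le; lra])).
  destruct prime_coef_le_8 as (H3 & H4' & H5 & _).
  unfold sum_f_R0; rewrite prime_coef_2, H3, H4', H5, !prime_coef_lt2 by lia; lra. }
(* With 3/14, the product with 7/4 is the 3/8 that makes cfun (3/2) < 4.  The
   bound (1 - 1/20)^30 on exp (-3/2) is just sharp enough for it. *)
assert (Hexp : 3 / 14 < exp (- (3 / 2))).
{ assert (H20 : 19 / 20 <= exp (- / 20))
    by (assert (H := exp_ineq1_le (- / 20)); lra).
  assert (Hn : forall n, (19 / 20) ^ n <= exp (INR n * - / 20)).
  { induction n as [|n IH]; [simpl; rewrite Rmult_0_l, exp_0; lra|].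
    rewrite S_INR, Rmult_plus_distr_r, exp_plus, Rmult_1_l, <- tech_pow_Rmult.
    rewrite Rmult_comm; apply Rmult_le_compat; [apply pow_le| | |]; lra. }
  apply Rlt_le_trans with ((19 / 20) ^ 30); [lra|].
  replace (- (3 / 2)) with (INR 30 * - / 20) by (simpl; lra); apply Hn. }
assert (Hup := Hmin (3 / 2) ltac:(lra)).
assert (cfun (3 / 2) < 4); [|lra].
assert (HQ : 3 / 8 < Q (3 / 2)) by (unfold Q; nra).
unfold cfun; apply Rlt_div_l; lra.
Qed.

Lemma slope_lambda_star : slope lambda_star = 0.
Proof.
destruct lambda_star_spec as [H0 Hmin].
assert (Hd := is_derive_cfun _ H0); apply is_derive_Reals in Hd.
assert (H := deriv_minimum cfun 0 (lambda_star + 1) lambda_star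
  (exist _ _ Hd) H0 ltac:(lra) ltac:(intros x Hx _; now apply Hmin)).
change (exp (- lambda_star) * (lambda_star ^ 2 * slope lambda_star)
        / Q lambda_star ^ 2 = 0) in H.
assert (He := exp_pos (- lambda_star)).
assert (HQ := pow_lt _ 2 (Q_pos _ H0)); assert (Hl := pow_lt _ 2 H0).
apply Rmult_integral in H; destruct H as [H|H].
- apply Rmult_integral in H; destruct H as [H|H]; [lra|].
  apply Rmult_integral in H; destruct H as [H|H]; [lra|exact H].
- apply Rinv_0_lt_compat in HQ; lra.
Qed.

(** The factor of [slope] in the derivative of [cfun] is positive, so a
    difference of values of [cfun] has the sign of [slope] at some strictly
    intermediate point.  This strictness allows [lambda_star], a zero of
    [slope], as an endpoint. *)
Lemma cfun_mvt x y : 0 < x -> x < y ->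
  exists z d, x < z < y /\ 0 < d /\ cfun y - cfun x = slope z * d.
Proof.
intros Hx Hxy.
destruct (MVT_cor2 cfun (fun z => exp (- z) * (z ^ 2 * slope z) / Q z ^ 2) x y Hxy)
  as [z [Hz Hxz]].
{ intros z Hz; apply is_derive_Reals, is_derive_cfun; lra. }
assert (HQ := Q_pos z ltac:(lra)).
exists z, (exp (- z) * z ^ 2 / Q z ^ 2 * (y - x)); split; [exact Hxz|split].
- apply Rmult_lt_0_compat; [|lra]; apply Rdiv_lt_0_compat; [|now apply pow_lt].
  apply Rmult_lt_0_compat; [apply exp_pos|apply pow_lt; lra].
- rewrite Hz; field; lra.
Qed.

Lemma cfun_decreasing x y :
  0 < x -> x < y -> y <= lambda_star -> cfun y < cfun x.
Proof.
intros Hx Hxy Hy; assert (H4 := lambda_star_lt_4).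
destruct (cfun_mvt x y Hx Hxy) as (z & d & Hz & Hd & He).
assert (Hs := slope_increasing z lambda_star ltac:(lra) ltac:(lra) ltac:(lra)).
rewrite slope_lambda_star in Hs; nra.
Qed.

Lemma cfun_increasing x y :
  lambda_star <= x -> x < y -> y <= 4 -> cfun x < cfun y.
Proof.
intros Hx Hxy Hy; destruct lambda_star_spec as [H0 _].
destruct (cfun_mvt x y ltac:(lra) Hxy) as (z & d & Hz & Hd & He).
assert (Hs := slope_increasing lambda_star z ltac:(lra) ltac:(lra) ltac:(lra)).
rewrite slope_lambda_star in Hs; nra.
Qed.

(** At a zero of [slope] the identity for [x Q'] gives [x Q' = Q > 0], and this
    positivity persists nearby by continuity. *)
Lemma Q_increasing_near : exists hi, lambda_star < hi <= 4 /\
  forall x y, lambda_star <= x -> x < y -> y <= hi -> Q x < Q y.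
Proof.
destruct lambda_star_spec as [H0 _]; assert (H4 := lambda_star_lt_4).
(* By Q_elasticity, w x = x Q'(x); this form shows its continuity. *)
set (w := fun x => Q x - exp (- x) * (x ^ 2 * slope x)).
assert (Hw : continuity_pt w lambda_star).
{ apply continuity_pt_minus; [apply Q_continuity|].
  apply continuity_pt_mult.
  - apply derivable_continuous_pt; reg.
  - apply continuity_pt_mult; [apply derivable_continuous_pt; reg|].
    apply PSeries_continuity, CV_radius_slope. }
assert (Hp : 0 < w lambda_star).
{ unfold w; rewrite slope_lambda_star, !Rmult_0_r, Rminus_0_r; now apply Q_pos. }
destruct (proj1 (continuity_pt_locally w lambda_star) Hw (mkposreal _ Hp))
  as [d Hd]; simpl in Hd.
assert (Hd0 := cond_pos d).
exists (Rmin (lambda_star + d / 2) 4).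
assert (Hm1 := Rmin_l (lambda_star + d / 2) 4).
assert (Hm2 := Rmin_r (lambda_star + d / 2) 4).
split; [split; [apply Rmin_glb_lt; lra|exact Hm2]|].
intros x y Hx Hxy Hy.
destruct (MVT_cor2 Q (Derive Q) x y Hxy) as [z [Hz Hxz]].
{ intros z _; apply is_derive_Reals, Derive_correct; eexists; apply is_derive_Q. }
assert (Hwz : Rabs (w z - w lambda_star) < w lambda_star).
{ apply Hd; change (Rabs (z - lambda_star) < d); apply Rabs_def1; lra. }
apply Rabs_def2 in Hwz.
assert (Hez := Q_elasticity z).
assert (Hwz0 : 0 < w z) by lra; unfold w in Hwz0.
assert (0 < Derive Q z); [|nra].
apply Rmult_lt_reg_l with z; lra.
Qed.


(** * Monotone orbits and stability *)

Lemma orbit_S (g : R -> R) x t : orbit g x (S t) = g (orbit g x t).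
Proof. reflexivity. Qed.

(** Conjugation by [x => - x] turns statements about increasing orbits into
    statements about decreasing ones. *)
Lemma orbit_opp (g : R -> R) x t :
  orbit (fun y => - g (- y)) (- x) t = - orbit g x t.
Proof.
induction t as [|t IH]; [reflexivity|].
now rewrite !orbit_S, IH, Ropp_involutive.
Qed.

Lemma orbit_lim_fixed (g : R -> R) (x l : R) :
  continuity_pt g l -> is_lim_seq (orbit g x) l -> g l = l.
Proof.
intros Hg Hl.
assert (H1 := is_lim_seq_continuous g (orbit g x) l Hg Hl).
assert (H2 := proj1 (is_lim_seq_incr_1 _ _) Hl).
apply is_lim_seq_unique in H1; apply is_lim_seq_unique in H2.
change (Lim_seq (fun n => g (orbit g x n)) = l) in H2; congruence.
Qed.

(** The orbit is increasing and bounded by [p]; its limit is a fixed point, and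
    [p] is the only one in the interval. *)
Lemma orbit_increasing_to_fixed (g : R -> R) (p y : R) :
  continuity g -> y < p -> g p = p ->
  (forall z, y <= z < p -> z < g z <= p) ->
  (forall t, y <= orbit g y t <= p) /\ is_lim_seq (orbit g y) p.
Proof.
intros Hc Hyp Hp Hg.
assert (Hgw : forall z, y <= z <= p -> z <= g z <= p).
{ intros z Hz; destruct (Req_dec z p) as [->|Hne]; [lra|].
  assert (H := Hg z); lra. }
assert (Hin : forall t, y <= orbit g y t <= p).
{ induction t as [|t IH]; [simpl; lra|].
  rewrite orbit_S; assert (H := Hgw _ IH); lra. }
split; [exact Hin|].
assert (Hincr : forall t, orbit g y t <= orbit g y (S t))
  by (intros t; rewrite orbit_S; apply Hgw, Hin).
destruct (ex_finite_lim_seq_incr (orbit g y) p Hincr (fun t => proj2 (Hin t)))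
  as [l Hl].
assert (Hly : y <= l) by (apply (is_lim_seq_incr_compare _ _ Hl Hincr 0)).
assert (Hlp : l <= p)
  by exact (is_lim_seq_le _ _ _ _ (fun t => proj2 (Hin t)) Hl (is_lim_seq_const p)).
assert (Hfix := orbit_lim_fixed g y l (Hc l) Hl).
destruct (Req_dec l p) as [<-|Hne]; [exact Hl|].
assert (H := Hg l); lra.
Qed.

Lemma orbit_decreasing_to_fixed (g : R -> R) (p y : R) :
  continuity g -> p < y -> g p = p ->
  (forall z, p < z <= y -> p <= g z < z) ->
  (forall t, p <= orbit g y t <= y) /\ is_lim_seq (orbit g y) p.
Proof.
intros Hc Hyp Hp Hg.
destruct (orbit_increasing_to_fixed (fun z => - g (- z)) (- p) (- y)) as [Hin Hl].
- intros z; apply continuity_pt_opp, (continuity_pt_comp Ropp g); [reg|apply Hc].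
- lra.
- now rewrite Ropp_involutive, Hp.
- intros z Hz; assert (H := Hg (- z)); lra.
- split.
  + intros t; specialize (Hin t); rewrite orbit_opp in Hin; lra.
  + apply is_lim_seq_opp in Hl; simpl in Hl; rewrite Ropp_involutive in Hl.
    revert Hl; apply is_lim_seq_ext; intros t.
    rewrite orbit_opp; apply Ropp_involutive.
Qed.

(** Orbits approach [p] from one side only, so their distance to [p] never
    exceeds the initial one: this is stability with [delta = min d eps].  The
    restriction to densities makes one of the two hypotheses void when [p] is
    an endpoint of the state space. *)
Lemma monotone_attraction_stable (g : R -> R) (p d : R) :
  continuity g -> g p = p -> 0 < d ->
  (forall z, density z -> p - d < z < p -> z < g z <= p) ->
  (forall z, density z -> p < z < p + d -> p <= g z < z) ->
  density p -> locally_asymptotically_stable g p.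
Proof.
intros Hc Hp Hd Hlo Hhi Hdp.
assert (H : forall y, density y -> Rabs (y - p) < d ->
  (forall t, Rabs (orbit g y t - p) <= Rabs (y - p)) /\ is_lim_seq (orbit g y) p).
{ intros y Hy Hyd; apply Rabs_def2 in Hyd; unfold density in *.
  destruct (Rtotal_order y p) as [Hlt|[Heq|Hgt]].
  - destruct (orbit_increasing_to_fixed g p y) as [Hin Hl]; auto.
    + intros z Hz; apply Hlo; lra.
    + split; [|exact Hl]; intros t; specialize (Hin t).
      rewrite !Rabs_left1; lra.
  - subst y; assert (Ho : forall t, orbit g p t = p).
    { induction t as [|t IH]; [reflexivity|]; now rewrite orbit_S, IH. }
    split; [intros t; rewrite Ho; lra|].
    apply is_lim_seq_ext with (2 := is_lim_seq_const p); now symmetry.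
  - destruct (orbit_decreasing_to_fixed g p y) as [Hin Hl]; auto.
    + intros z Hz; apply Hhi; lra.
    + split; [|exact Hl]; intros t; specialize (Hin t).
      rewrite !Rabs_pos_eq; lra. }
split.
- intros eps Heps; exists (Rmin d eps); split; [now apply Rmin_glb_lt|].
  intros y Hy Hyd t.
  assert (Hm1 := Rmin_l d eps); assert (Hm2 := Rmin_r d eps).
  apply Rle_lt_trans with (Rabs (y - p)); [|lra].
  apply H; [exact Hy|lra].
- exists d; split; [exact Hd|]; intros y Hy Hyd; now apply H.
Qed.

(** If the orbit of a point just above [p] stayed in the lower half of the
    interval, it would increase to a fixed point strictly inside the interval,
    where there is none. *)
Lemma repelling_unstable (g : R -> R) (p q : R) :
  continuity g -> p < q -> density p -> density q ->
  (forall z, p < z < q -> z < g z) -> unstable g p.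
Proof.
intros Hc Hpq Hp Hq Hg Hs.
destruct (Hs ((q - p) / 2)) as [d [Hd Hs']]; [lra|].
set (e := Rmin (d / 2) ((q - p) / 2)).
assert (He1 : e <= d / 2) by apply Rmin_l.
assert (He2 : e <= (q - p) / 2) by apply Rmin_r.
assert (He0 : 0 < e) by (apply Rmin_glb_lt; lra).
set (y := p + e).
assert (Hup : forall t, orbit g y t <= (p + q) / 2).
{ intros t; unfold density in *.
  assert (H : Rabs (orbit g y t - p) < (q - p) / 2).
  { apply Hs'; unfold density, y; [lra|rewrite Rabs_pos_eq; lra]. }
  apply Rabs_def2 in H; lra. }
assert (Hlo : forall t, y <= orbit g y t).
{ induction t as [|t IH]; [simpl; lra|]; rewrite orbit_S.
  assert (H := Hg (orbit g y t)); specialize (Hup t); unfold y in *; lra. }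
assert (Hincr : forall t, orbit g y t <= orbit g y (S t)).
{ intros t; rewrite orbit_S; apply Rlt_le, Hg.
  specialize (Hup t); specialize (Hlo t); unfold y in *; lra. }
destruct (ex_finite_lim_seq_incr (orbit g y) _ Hincr Hup) as [l Hl].
assert (Hly : y <= l) by (apply (is_lim_seq_incr_compare _ _ Hl Hincr 0)).
assert (Hlq : l <= (p + q) / 2)
  by exact (is_lim_seq_le _ _ _ _ Hup Hl (is_lim_seq_const _)).
assert (Hfix := orbit_lim_fixed g y l (Hc l) Hl).
assert (H := Hg l); unfold y in *; lra.
Qed.

(** * Inverse branches *)

(** The inverse is chosen by the epsilon operator; it is constrained only on the
    open range of values, and the limit at its lower end is one-sided. *)
Lemma increasing_inverse_branch (f : R -> R) (a b : R) :
  a < b -> (forall x, a <= x <= b -> continuity_pt f x) ->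
  (forall x y, a <= x -> x < y -> y <= b -> f x < f y) ->
  exists h : R -> R,
    (forall c, f a < c < f b -> a < h c < b /\ f (h c) = c /\ continuous h c) /\
    filterlim h (at_right (f a)) (locally a).
Proof.
intros Hab Hc Hinc.
pose (h := fun c => epsilon (inhabits 0) (fun x => a < x < b /\ f x = c)).
assert (Hh : forall c, f a < c < f b -> a < h c < b /\ f (h c) = c).
{ intros c Hfc; apply (epsilon_spec (inhabits 0) (fun x => a < x < b /\ f x = c)).
  destruct (IVT_interv (fun x => f x - c) a b) as [x [Hx Hfx]]; try lra.
  - intros x Hx; apply continuity_pt_minus; [now apply Hc|].
    now apply continuity_pt_const.
  - assert (x <> a) by (intros ->; lra); assert (x <> b) by (intros ->; lra).
    exists x; lra. }
assert (Hlt : forall x y, a <= x <= b -> a <= y <= b -> f x < f y -> x < y).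
{ intros x y Hx Hy Hf; destruct (Rtotal_order x y) as [H|[H|H]]; [easy| |].
  - subst; lra.
  - specialize (Hinc y x); lra. }
exists h; split.
- intros c Hfc; destruct (Hh c Hfc) as [Hhc Hfh]; split; [easy|split; [easy|]].
  apply filterlim_locally; intros [eps Heps]; simpl.
  set (x1 := Rmax a (h c - eps / 2)); set (x2 := Rmin b (h c + eps / 2)).
  assert (H1 : a <= x1 /\ h c - eps / 2 <= x1 < h c).
  { unfold x1; split; [apply Rmax_l|split; [apply Rmax_r|apply Rmax_lub_lt; lra]]. }
  assert (H2 : x2 <= b /\ h c < x2 <= h c + eps / 2).
  { unfold x2; split; [apply Rmin_l|split; [apply Rmin_glb_lt; lra|apply Rmin_r]]. }
  assert (Hf1 : f x1 < c) by (rewrite <- Hfh; apply Hinc; lra).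
  assert (Hf2 : c < f x2) by (rewrite <- Hfh at 1; apply Hinc; lra).
  apply (locally_interval _ c (Rmax (f a) (f x1)) (Rmin (f b) (f x2))); simpl.
  + now apply Rmax_lub_lt.
  + now apply Rmin_glb_lt.
  + intros c' Hc1 Hc2.
    apply Rmax_Rlt in Hc1; apply Rmin_Rgt in Hc2.
    destruct (Hh c') as [Hhc' Hfh']; [lra|].
    assert (x1 < h c') by (apply Hlt; lra).
    assert (h c' < x2) by (apply Hlt; lra).
    change (Rabs (h c' - h c) < eps); apply Rabs_def1; lra.
- apply filterlim_locally; intros [eps Heps]; simpl.
  set (x2 := Rmin b (a + eps / 2)).
  assert (H2 : x2 <= b /\ a < x2 <= a + eps / 2).
  { unfold x2; split; [apply Rmin_l|split; [apply Rmin_glb_lt; lra|apply Rmin_r]]. }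
  assert (Hf2 : f a < f x2) by (apply Hinc; lra).
  assert (Hf2b : f x2 <= f b).
  { destruct (Req_dec x2 b) as [->|]; [lra|apply Rlt_le, Hinc; lra]. }
  apply (locally_interval _ (f a) m_infty (f x2)); simpl; [easy|easy|].
  intros c' _ Hc2 Hc1.
  destruct (Hh c') as [Hhc' Hfh']; [lra|].
  assert (h c' < x2) by (apply Hlt; lra).
  change (Rabs (h c' - a) < eps); apply Rabs_def1; lra.
Qed.

Lemma decreasing_inverse_branch (f : R -> R) (a b : R) :
  a < b -> (forall x, a <= x <= b -> continuity_pt f x) ->
  (forall x y, a <= x -> x < y -> y <= b -> f y < f x) ->
  exists h : R -> R,
    (forall c, f b < c < f a -> a < h c < b /\ f (h c) = c /\ continuous h c) /\
    filterlim h (at_right (f b)) (locally b).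
Proof.
intros Hab Hc Hdec.
destruct (increasing_inverse_branch (fun x => f (- x)) (- b) (- a)) as [h [Hh Hl]].
- lra.
- intros x Hx; apply (continuity_pt_comp Ropp f); [reg|apply Hc; lra].
- intros x y Hx Hxy Hy; apply Hdec; lra.
- rewrite !Ropp_involutive in *.
  exists (fun c => - h c); split.
  + intros c Hfc; destruct (Hh c Hfc) as (H1 & H2 & H3).
    split; [lra|split; [exact H2|]].
    now apply (continuous_opp h).
  + apply filterlim_comp with (1 := Hl).
    rewrite <- (Ropp_involutive b) at 2.
    apply (filterlim_opp (- b)).
Qed.

(** * The mean-field map *)

Lemma cfun_continuity_pt x : 0 < x -> continuity_pt cfun x.
Proof.
intros Hx; apply derivable_continuous_pt.
eexists; now apply is_derive_Reals, is_derive_cfun.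
Qed.

Lemma Q_0 : Q 0 = 0.
Proof. unfold Q, Phi; rewrite PSeries_0, prime_coef_lt2 by lia; ring. Qed.

Lemma mean_field_continuity c : continuity (mean_field c).
Proof.
intros x; apply (continuity_pt_comp (fun y => c * y) Q); [reg|apply Q_continuity].
Qed.

Lemma mean_field_lt c y : 0 < c -> 0 < y -> c < cfun (c * y) -> mean_field c y < y.
Proof.
intros Hc Hy H; assert (Hcy := Rmult_lt_0_compat _ _ Hc Hy).
assert (HQ := Q_pos _ Hcy); unfold cfun in H.
apply (Rlt_div_r c (c * y) _ HQ) in H.
apply Rmult_lt_reg_l with c; [exact Hc|exact H].
Qed.

Lemma mean_field_gt c y : 0 < c -> 0 < y -> cfun (c * y) < c -> y < mean_field c y.
Proof.
intros Hc Hy H; assert (Hcy := Rmult_lt_0_compat _ _ Hc Hy).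
assert (HQ := Q_pos _ Hcy); unfold cfun in H.
apply (Rlt_div_l (c * y) c _ HQ) in H.
apply Rmult_lt_reg_l with c; [exact Hc|exact H].
Qed.

Lemma mean_field_fixed l c :
  0 < l -> cfun l = c -> is_fixed_point (mean_field c) (l / c).
Proof.
intros Hl <-; assert (Hb := Q_bounds l Hl).
replace (l / cfun l) with (Q l) by (unfold cfun; field; lra).
split; [unfold density; lra|].
unfold mean_field; f_equal; unfold cfun; field; lra.
Qed.

(** The limit is [lambda_star / c_star], which is [Q lambda_star] by the
    definition of [cfun]. *)
Lemma filterlim_branch_density (h : R -> R) :
  filterlim h (at_right c_star) (locally lambda_star) ->
  filterlim (fun c => h c / c) (at_right c_star) (locally rho_star).
Proof.
destruct lambda_star_spec as [H0 _]; assert (HQ := Q_pos _ H0).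
intros Hh.
assert (Hc : 0 < c_star) by now apply Rdiv_lt_0_compat.
replace rho_star with (lambda_star * / c_star)
  by (unfold rho_star, c_star, cfun; field; lra).
apply (filterlim_comp_2 h Rinv Rmult
  (G := locally lambda_star) (H := locally (/ c_star))).
- exact Hh.
- apply (filterlim_filter_le_1 (F := locally c_star)); [apply filter_le_within|].
  apply continuous_Rinv; lra.
- apply (filterlim_mult lambda_star (/ c_star)).
Qed.

Theorem proposition19 :
  exists eps : R, 0 < eps /\
  exists rho_minus rho_plus : R -> R,
    (forall c : R, c_star < c < c_star + eps ->
       is_fixed_point (mean_field c) (rho_minus c) /\
       is_fixed_point (mean_field c) (rho_plus c) /\
       0 < rho_minus c /\ rho_minus c < rho_plus c /\
       continuous rho_minus c /\ continuous rho_plus c /\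
       unstable (mean_field c) (rho_minus c) /\
       locally_asymptotically_stable (mean_field c) (rho_plus c) /\
       is_fixed_point (mean_field c) 0 /\
       locally_asymptotically_stable (mean_field c) 0 /\
       bistable (mean_field c)) /\
    filterlim rho_minus (at_right c_star) (locally rho_star) /\
    filterlim rho_plus (at_right c_star) (locally rho_star).
Proof.
destruct lambda_star_spec as [H0 _]; assert (HQ := Q_pos _ H0).
assert (Hcs : 0 < c_star) by now apply Rdiv_lt_0_compat.
destruct Q_increasing_near as (hi & Hhi & HQinc).
(* On the left of lambda_star any starting point will do: cfun decreases on
   the whole of (0, lambda_star]. *)
set (lo := lambda_star / 2).
destruct (decreasing_inverse_branch cfun lo lambda_star) as (hm & Hm & Lm).
{ unfold lo; lra. }
{ intros x Hx; apply cfun_continuity_pt; unfold lo in *; lra. }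
{ intros x y Hx Hxy Hy; apply cfun_decreasing; unfold lo in *; lra. }
destruct (increasing_inverse_branch cfun lambda_star hi) as (hp & Hp & Lp).
{ lra. }
{ intros x Hx; apply cfun_continuity_pt; lra. }
{ intros x y Hx Hxy Hy; apply cfun_increasing; lra. }
fold c_star in Hm, Lm, Hp, Lp.
assert (Hclo : c_star < cfun lo) by (apply cfun_decreasing; unfold lo; lra).
assert (Hchi : c_star < cfun hi) by (apply cfun_increasing; lra).
exists (Rmin (cfun lo) (cfun hi) - c_star); split.
{ assert (H := Rmin_glb_lt _ _ _ Hclo Hchi); lra. }
exists (fun c => hm c / c), (fun c => hp c / c); split;
  [|split; now apply filterlim_branch_density].
intros c Hc.
assert (Hmin1 := Rmin_l (cfun lo) (cfun hi)).
assert (Hmin2 := Rmin_r (cfun lo) (cfun hi)).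
destruct (Hm c ltac:(lra)) as (Hm1 & Hm2 & Hm3).
destruct (Hp c ltac:(lra)) as (Hp1 & Hp2 & Hp3).
assert (Hlo : 0 < lo) by (unfold lo; lra).
assert (Hc0 : 0 < c) by lra.
assert (Fm : is_fixed_point (mean_field c) (hm c / c)) by (apply mean_field_fixed; lra).
assert (Fp : is_fixed_point (mean_field c) (hp c / c)) by (apply mean_field_fixed; lra).
assert (F0 : is_fixed_point (mean_field c) 0).
{ split; [unfold density; lra|]; unfold mean_field; rewrite Rmult_0_r; apply Q_0. }
assert (Hrm : 0 < hm c / c) by (apply Rdiv_lt_0_compat; lra).
assert (Hrmp : hm c / c < hp c / c).
{ apply Rmult_lt_compat_r; [now apply Rinv_0_lt_compat|lra]. }
assert (Hscale : forall l y, (y < l / c -> c * y < l) /\ (l / c < y -> l < c * y)).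
{ intros l y; split; intros H.
  - apply (Rlt_div_r y l c Hc0) in H; lra.
  - apply (Rlt_div_l l y c Hc0) in H; lra. }
assert (Um : unstable (mean_field c) (hm c / c)).
{ apply (repelling_unstable _ _ (hp c / c)).
  - apply mean_field_continuity.
  - exact Hrmp.
  - apply Fm.
  - apply Fp.
  - intros z Hz; apply mean_field_gt; [lra|lra|].
    assert (H1 := proj2 (Hscale (hm c) z) ltac:(lra)).
    assert (H2 := proj1 (Hscale (hp c) z) ltac:(lra)).
    destruct (Rle_lt_dec (c * z) lambda_star) as [Hz'|Hz'].
    + rewrite <- Hm2 at 2; apply cfun_decreasing; lra.
    + rewrite <- Hp2 at 2; apply cfun_increasing; lra. }
assert (Sp : locally_asymptotically_stable (mean_field c) (hp c / c)).
(* The radius d keeps c * z between lambda_star and hi, where both cfun and Q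
   are increasing. *)
{ set (d := Rmin (hp c / c - lambda_star / c) (hi / c - hp c / c)).
  assert (Hd1 : d <= hp c / c - lambda_star / c) by apply Rmin_l.
  assert (Hd2 : d <= hi / c - hp c / c) by apply Rmin_r.
  apply (monotone_attraction_stable _ _ d).
  - apply mean_field_continuity.
  - apply Fp.
  - assert (Hci := Rinv_0_lt_compat _ Hc0).
    assert (lambda_star / c < hp c / c) by (apply Rmult_lt_compat_r; lra).
    assert (hp c / c < hi / c) by (apply Rmult_lt_compat_r; lra).
    apply Rmin_glb_lt; lra.
  - intros z [Hz0 _] Hz.
    assert (H1 := proj2 (Hscale lambda_star z) ltac:(lra)).
    assert (H2 := proj1 (Hscale (hp c) z) ltac:(lra)).
    assert (Hzpos : 0 < z) by nra.
    split.
    + apply mean_field_gt; [lra|lra|].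
      rewrite <- Hp2 at 2; apply cfun_increasing; lra.
    + rewrite <- (proj2 Fp); unfold mean_field at 2.
      replace (c * (hp c / c)) with (hp c) by (field; lra).
      apply Rlt_le, HQinc; lra.
  - intros z [Hz0 _] Hz.
    assert (H1 := proj2 (Hscale (hp c) z) ltac:(lra)).
    assert (H2 := proj1 (Hscale hi z) ltac:(lra)).
    split.
    + rewrite <- (proj2 Fp) at 1; unfold mean_field at 1.
      replace (c * (hp c / c)) with (hp c) by (field; lra).
      apply Rlt_le, HQinc; lra.
    + apply mean_field_lt; [lra|nra|].
      rewrite <- Hp2 at 1; apply cfun_increasing; lra.
  - apply Fp. }
assert (S0 : locally_asymptotically_stable (mean_field c) 0).
{ apply (monotone_attraction_stable _ _ (hm c / c)).
  - apply mean_field_continuity.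
  - apply F0.
  - exact Hrm.
  - intros z [Hz _] Hz'; lra.
  - intros z Hzd Hz; split; [now apply mean_field_density|].
    assert (H1 := proj1 (Hscale (hm c) z) ltac:(lra)).
    apply mean_field_lt; [lra|lra|].
    rewrite <- Hm2 at 1; apply cfun_decreasing; nra.
  - apply F0. }
assert (Cdiv : forall h : R -> R, continuous h c -> continuous (fun u => h u / u) c).
{ intros h Hh; apply (continuous_mult h Rinv); [exact Hh|apply continuous_Rinv; lra]. }
repeat split; try apply Fm; try apply Fp; try apply F0; try apply Sp; try apply S0;
  try lra; auto.
exists 0, (hp c / c); repeat split; try apply F0; try apply S0; try apply Fp;
  try apply Sp; lra.
Qed.
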